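(* Let $p$ be an odd prime number. Then there exist exactly $(p+1)/2$ sequences $(a,b,c,d)$ of four elements of $\mathbb N=\{0,1,2,\ldots\}$ such that $p=ab+cd$ and $\min(a,b)>\max(c,d)$.
   Context: $\mathbb N=\{0,1,2,\ldots\}$ denotes the set of non-negative integers. Sequences are ordered, so e.g. $(a,b,c,d)$ and $(b,a,c,d)$ are counted as different if $a\neq b$. *)

(* Defs.v *)
From mathcomp Require Import all_boot.
From mathcomp Require Import boolp classical_sets functions cardinality.

Set Implicit Arguments.
Unset Strict Implicit.
Unset Printing Implicit Defensive.

(* Main.v *)
(** A solution (a, b, c, d) with c, d > 0 gives vectors u = (a, c), v = (-d, b) of
determinant p, hence a basis of the index-p lattice {(x, y) | x = m y mod p} with
m = a / c mod p.  Conversely, a lattice with m distinct from 0, 1, -1 and infinity has,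
up to replacing m by -m, exactly one such basis: one vector is a nonzero lattice vector
of smallest sup norm, and the other is obtained from it by a Bezout relation and
Euclidean division.  So these solutions correspond to the classes 2 <= m <= (p - 1) / 2
of m up to sign; the two solutions (1, p, 0, 0) and (p, 1, 0, 0) bring the total to
(p + 1) / 2. *)
Require Import Defs.
From mathcomp Require Import all_boot all_order all_algebra.
From mathcomp Require Import boolp classical_sets functions cardinality.
From mathcomp Require Import zify ring.

Set Implicit Arguments.
Unset Strict Implicit.
Unset Printing Implicit Defensive.

Section Lattice.
Import GRing.Theory.
Local Open Scope ring_scope.

(** * Lattice vectors and their sup norm *)

Lemma prime_lt_charF (F : fieldType) (p n : nat) :
  p \in [pchar F] -> (0 < n < p)%N -> n%:R != 0 :> F.
Proof.
move=> charF /andP[n_gt0 n_lt]; rewrite -(dvdn_pcharf charF).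
by apply/negP => /(dvdn_leq n_gt0); lia.
Qed.

(* Cramer's rule for the basis (a, c), (-d, b) of determinant p. *)
Lemma lattice_coordinates (p : nat) (a b c d x y : int) :
  prime p -> 0 < a < p%:Z -> p%:Z = a * b + c * d -> (p %| a * y - c * x)%Z ->
  exists i j : int, x = i * a - j * d /\ y = i * c + j * b.
Proof.
move=> p_prime /andP[a_gt0 a_ltp] pE /dvdzP[j jE].
have cop : coprimez p a.
  case: a a_gt0 a_ltp {pE jE} => // n n_gt0 n_ltp.
  rewrite /coprimez /gcdz /= eqz_nat -/(coprime _ _) prime_coprime //.
  by apply/negP => /dvdn_leq; lia.
(* The coordinates are [i = (b x + d y) / p] and [j = (a y - c x) / p]. Integrality of [i] follows
   from that of [j] because [a] is prime to [p]. *)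
have : (p %| a * (b * x + d * y))%Z.
  apply/dvdzP; exists (x + d * j).
  have -> : a * (b * x + d * y) = x * (a * b + c * d) + d * (a * y - c * x) by ring.
  by rewrite jE -pE; ring.
rewrite Gauss_dvdzr // => /dvdzP[i iE].
have p_neq0 : p%:Z != 0 by have := prime_gt0 p_prime; lia.
exists i, j; split; apply: (mulfI p_neq0).
  have -> : p%:Z * (i * a - j * d) = a * (i * p) - d * (j * p) by ring.
  by rewrite -iE -jE pE; ring.
have -> : p%:Z * (i * c + j * b) = c * (i * p) + b * (j * p) by ring.
by rewrite -iE -jE pE; ring.
Qed.

(** Off the axes the signs decide: if [i] and [j] agree, then [|y| >= b + c > a]; if [i > 0 > j],
    then [x >= a + d > a]; if [i < 0 < j], then [x < 0]. On the axes only multiples of the two basis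
    vectors remain. *)
Lemma short_vector (a b c d x y i j : int) :
  0 < c < a -> 0 < d < a -> a <= b ->
  0 <= x -> 0 < x + `|y| -> x = i * a - j * d -> y = i * c + j * b ->
  (a <= x \/ a <= `|y|) /\
  (x <= a -> `|y| <= a ->
   (x = a /\ `|y| = c) \/ (a = b /\ x = d /\ `|y| = b)).
Proof.
move=> ? ? ? x_ge0 xy xE yE.
have [i0|[i0|i0]] : i = 0 \/ (1 <= i \/ i <= -1) by lia.
- rewrite {}i0 in xE yE.
  have [j0|[j0|j0]] : j = 0 \/ (1 <= j \/ j <= -1) by lia.
  + by subst j; lia.
  + by nia.
  + have [j1|j1] : j = -1 \/ j <= -2 by lia.
      by subst j; split; lia.
    have : j * b <= -2 * b by nia.
    by split; lia.
- have [j0|[j0|j0]] : j = 0 \/ (1 <= j \/ j <= -1) by lia.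
  + have [i1|i1] : i = 1 \/ 2 <= i by lia.
      by subst i j; split; lia.
    have : i * a >= 2 * a by nia.
    by split; lia.
  + have : i * c >= c by nia.
    have : j * b >= b by nia.
    by split; lia.
  + have : i * a >= a by nia.
    have : j * d <= - d by nia.
    by split; lia.
- have [j0|[j0|j0]] : j = 0 \/ (1 <= j \/ j <= -1) by lia.
  + have : i * a <= - a by nia.
    by subst j; lia.
  + have : i * a <= - a by nia.
    have : j * d >= d by nia.
    by lia.
  + have : i * c <= - c by nia.
    have : j * b <= - b by nia.
    by split; lia.
Qed.

(* With k1 = 1 and k2 = m ^+ 2 this says x = m y or x = - m y, so it treats the lattices
   of m and -m together; two coefficients make the exchange of the axes a symmetry. *)
Definition sqr_prop (F : fieldType) (k1 k2 : F) (x y : nat) :=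
  k1 * x%:R ^+ 2 = k2 * y%:R ^+ 2.

(** The determinant [p] vanishes in [F], so [a b = - c d] there; multiplying the claim by the
    invertible [c ^+ 2] reduces it to the relation for [(a, c)]. *)
Lemma sqr_prop_partner (F : fieldType) (p a b c d : nat) (k1 k2 : F) :
  p \in [pchar F] -> p = (a * b + c * d)%N -> (0 < c < p)%N ->
  sqr_prop k1 k2 a c -> sqr_prop k1 k2 d b.
Proof.
move=> charF pE c_ltp; rewrite /sqr_prop => kac.
have abE : a%:R * b%:R = - (c%:R * d%:R) :> F.
  by apply/eqP; rewrite -addr_eq0 -!natrM -natrD -pE pcharf0.
have c2 : c%:R ^+ 2 != 0 :> F by rewrite sqrf_eq0 (prime_lt_charF charF).
apply: (mulfI c2).
have -> : c%:R ^+ 2 * (k1 * d%:R ^+ 2) = k1 * (- (c%:R * d%:R)) ^+ 2 by ring.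
rewrite -abE.
have -> : k1 * (a%:R * b%:R) ^+ 2 = k1 * a%:R ^+ 2 * b%:R ^+ 2 by ring.
by rewrite kac; ring.
Qed.

(** The two relations give [(a y)^2 = (c x)^2] in [F], hence [a y = c x] or [a y = - c x]. With the
    matching sign on [y], the vector lies in the lattice spanned by [(a, c)] and [(-d, b)], where
    [short_vector] applies. *)
Lemma sqr_prop_minimal (F : fieldType) (p a b c d x y : nat) (k1 k2 : F) :
  p \in [pchar F] -> p = (a * b + c * d)%N ->
  (0 < c < a)%N -> (0 < d < a)%N -> (a <= b)%N -> k2 != 0 ->
  sqr_prop k1 k2 a c -> sqr_prop k1 k2 x y -> (0 < maxn x y)%N ->
  (a <= maxn x y)%N /\
  (maxn x y = a -> (x = a /\ y = c) \/ (a = b /\ x = d /\ y = b)).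
Proof.
move=> charF pE ca da ab k2_neq0 kac kxy xy_gt0.
have p_prime := pcharf_prime charF.
have a_ltp : (a < p)%N by rewrite pE; nia.
have [Y [absY dvdY]] : exists Y : int, `|Y| = y%:Z /\ (p %| a%:Z * Y - c%:Z * x%:Z)%Z.
  have : (a%:R * y%:R) ^+ 2 == (c%:R * x%:R) ^+ 2 :> F.
    apply/eqP/(mulfI k2_neq0).
    have -> : k2 * (a%:R * y%:R) ^+ 2 = a%:R ^+ 2 * (k2 * y%:R ^+ 2) by ring.
    rewrite -kxy.
    have -> : a%:R ^+ 2 * (k1 * x%:R ^+ 2) = x%:R ^+ 2 * (k1 * a%:R ^+ 2) by ring.
    by rewrite kac; ring.
  rewrite eqf_sqr => /orP[] /eqP e.
    exists y%:Z; split; first lia.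
    by rewrite (dvdz_pcharf charF) rmorphB !rmorphM /= -!pmulrn e subrr.
  exists (- y%:Z); split; first lia.
  by rewrite (dvdz_pcharf charF) rmorphB !rmorphM rmorphN /= -!pmulrn mulrN e opprK subrr.
have [||i [j [xE yE]]] := @lattice_coordinates p a b c d x Y p_prime _ _ dvdY.
- by lia.
- by rewrite pE PoszD !PoszM.
by have [|||||] := @short_vector a b c d x Y i j _ _ _ _ _ xE yE; lia.
Qed.

(** * Uniqueness of the solution in a given class *)

(** Once the vector [(a, c)] is known, its partner is too: [c] is invertible modulo [a], so [d] is
    determined modulo [a], and it is reduced. *)
Lemma remainder_unique (a b c d b' d' : nat) : coprime a c ->
  (d < a)%N -> (d' < a)%N -> (a * b + c * d = a * b' + c * d')%N ->
  b = b' /\ d = d'.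
Proof.
move=> cop d_lt d'_lt e.
wlog dd' : b d b' d' d_lt d'_lt e / (d <= d')%N.
  move=> H; have [le|/ltnW le] := leqP d d'; first exact: H.
  by have [-> ->] := H _ _ _ _ d'_lt d_lt (esym e) le.
have : (a %| c * (d' - d))%N by apply/dvdnP; exists (b - b')%N; nia.
rewrite Gauss_dvdr // => /dvdnP[k kE].
have dE : d = d' by case: k kE => [|k]; rewrite ?mulSn; lia.
by split=> //; subst d'; nia.
Qed.

Definition primitive_sol (F : fieldType) (p : nat) (k1 k2 : F) (a b c d : nat) :=
  [/\ p = (a * b + c * d)%N, (maxn c d < minn a b)%N, (0 < c)%N, (0 < d)%N
    & sqr_prop k1 k2 a c].

(** Exchange of the coordinate axes, which later reduces everything to [a <= b]. *)
Lemma primitive_sol_swap (F : fieldType) (p : nat) (k1 k2 : F) (a b c d : nat) :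
  p \in [pchar F] ->
  primitive_sol p k1 k2 a b c d -> primitive_sol p k2 k1 b a d c.
Proof.
move=> charF [pE lt c_gt0 d_gt0 kac]; split=> //; first by rewrite pE; lia.
  by lia.
by rewrite /sqr_prop (sqr_prop_partner charF pE _ kac) //; nia.
Qed.

Lemma primitive_sol_unique_le (F : fieldType) (p : nat) (k1 k2 : F)
    (a b c d a' b' c' d' : nat) :
  p \in [pchar F] -> k1 != 0 -> k2 != 0 -> (a <= b)%N ->
  primitive_sol p k1 k2 a b c d -> primitive_sol p k1 k2 a' b' c' d' ->
  [/\ a = a', b = b', c = c' & d = d'].
Proof.
move=> charF k1_neq0 k2_neq0 ab sol sol'.
have p_prime := pcharf_prime charF.
have [pE lt c_gt0 d_gt0 kac] := sol.
have [pE' lt' c'_gt0 d'_gt0 kac'] := sol'.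
have [ab'|ab'] := leqP a' b'.
  (* Both [(a, c)] and [(a', c')] are shortest, so [a = a']; the alternative [c' = b] is excluded by
     [c' < a']. *)
  have [|||] := sqr_prop_minimal charF pE _ _ ab k2_neq0 kac kac'; try lia.
  move=> le1 eq1.
  have [|||] := sqr_prop_minimal charF pE' _ _ ab' k2_neq0 kac' kac; try lia.
  move=> le2 _.
  have aE : a' = a by lia.
  have cE : c' = c by lia.
  subst a' c'.
  have cop : coprime a c.
    have : (gcdn a c %| p)%N.
      by rewrite pE dvdn_add // dvdn_mulr // (dvdn_gcdl, dvdn_gcdr).
    have /dvdn_leq := dvdn_gcdl a c.
    move/primeP: p_prime => [_ H] gle /H /orP[|/eqP]; first by [].
    by nia.
  by have [|||-> ->] := @remainder_unique a b c d b' d' cop; try lia.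
(* If [b' < a'], the second solution has only the shortest vector [(d', b')] up to signs, longer
   along the other axis. Then [(a, c)], which must be equally short, cannot exist. *)
have [_ _ _ _ kbd'] := primitive_sol_swap charF sol'.
have [|||] := sqr_prop_minimal charF pE _ _ ab k2_neq0 kac (esym kbd'); try lia.
move=> le1 eq1.
have pE2 : p = (b' * a' + d' * c')%N by lia.
by have [|||] := sqr_prop_minimal charF pE2 _ _ (ltnW ab') k1_neq0 kbd' (esym kac); lia.
Qed.

Lemma primitive_sol_unique (F : fieldType) (p : nat) (k1 k2 : F)
    (a b c d a' b' c' d' : nat) :
  p \in [pchar F] -> k1 != 0 -> k2 != 0 ->
  primitive_sol p k1 k2 a b c d -> primitive_sol p k1 k2 a' b' c' d' ->
  [/\ a = a', b = b', c = c' & d = d'].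
Proof.
move=> charF k1_neq0 k2_neq0 sol sol'; have [ab|ba] := leqP a b.
  exact: (primitive_sol_unique_le charF k1_neq0 k2_neq0 ab sol sol').
by have [] := primitive_sol_unique_le charF k2_neq0 k1_neq0 (ltnW ba)
  (primitive_sol_swap charF sol) (primitive_sol_swap charF sol').
Qed.

(** * Degenerate solutions, and existence in a given class *)

Lemma degenerate_sol (p a b c d : nat) : prime p ->
  p = (a * b + c * d)%N -> (maxn c d < minn a b)%N -> (c == 0%N) || (d == 0%N) ->
  [/\ c = 0%N, d = 0%N & (a = 1 /\ b = p \/ a = p /\ b = 1)%N].
Proof.
move=> p_prime pE lt cd0.
have pab : p = (a * b)%N by case/orP: cd0 => /eqP e; rewrite e in pE; lia.
have : (a %| p)%N by rewrite pab dvdn_mulr.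
case/primeP: (p_prime) => p_gt1 H /H /orP[]/eqP aE.
  by split; try lia; left; lia.
have : b = 1%N by nia.
by move=> bE; split; try lia; right; lia.
Qed.

(** A Bezout relation and a division complete [(a, c)] to a basis of determinant [p]; minimality of
    [a] then bounds [|b|] from below. *)
Lemma minimal_vector_extends (F : fieldType) (p : nat) (k1 k2 : F) (a c : nat) :
  p \in [pchar F] -> (0 < c < a)%N -> (a < p)%N -> sqr_prop k1 k2 a c ->
  (forall x y, (0 < maxn x y)%N -> sqr_prop k1 k2 x y -> (a <= maxn x y)%N) ->
  exists b d, primitive_sol p k1 k2 a b c d.
Proof.
move=> charF ca a_ltp kac min_a.
have p_prime := pcharf_prime charF.
(* Dividing by the gcd, which is invertible in [F], keeps the relation, so minimality forces the gcd
   to be 1. *)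
have cop : coprime a c.
  have /dvdnP[a' aE] := dvdn_gcdl a c.
  have /dvdnP[c' cE] := dvdn_gcdr a c.
  have g_gt0 : (0 < gcdn a c)%N by rewrite gcdn_gt0; lia.
  have g_le : (gcdn a c <= a)%N by rewrite dvdn_leq ?dvdn_gcdl //; lia.
  rewrite /coprime; move: (gcdn a c) => g in aE cE g_gt0 g_le *.
  have g0 : g%:R ^+ 2 != 0 :> F.
    by rewrite sqrf_eq0 (prime_lt_charF charF) //; lia.
  have kac' : sqr_prop k1 k2 a' c'.
    by apply: (mulIf g0); move: kac; rewrite /sqr_prop aE cE !natrM !exprMn !mulrA.
  have := min_a _ _ _ kac'.
  by nia.
(* Here [p = a (p u) + c (p v)]; the remainder of [p v] modulo [a] becomes [d], and the quotient is
   moved into [b]. *)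
have [u [v uv]] := Bezoutz a c.
have {}uv : u * a + v * c = 1 by rewrite uv /gcdz /= (eqP cop).
have a0 : a%:Z != 0 by lia.
have := divz_eq (p%:Z * v) a; have := modz_ge0 (p%:Z * v) a0.
have := @ltz_pmod (p%:Z * v) a ltac:(lia).
set q := (_ %/ _)%Z; set r := (_ %% _)%Z => r_lt r_ge0 qr.
have pE : p%:Z = a%:Z * (p%:Z * u + q * c) + c%:Z * r.
  have -> : a%:Z * (p%:Z * u + q * c) + c%:Z * r = p%:Z * u * a + c%:Z * (q * a + r) by ring.
  by rewrite -qr -[LHS]mulr1 -uv; ring.
set b := p%:Z * u + q * c in pE.
have [d dE] : exists d : nat, r = d by exists `|r|%N; lia.
rewrite {}dE in pE r_lt r_ge0 qr.
(* The computation of [sqr_prop_partner] again, now with [b] an integer of still unknown sign. *)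
have kdb : sqr_prop k1 k2 d `|b|%N.
  apply: (mulfI (_ : c%:R ^+ 2 != 0)).
    by rewrite sqrf_eq0 (prime_lt_charF charF) //; lia.
  have abE : a%:R * b%:~R = - (c%:R * d%:R) :> F.
    apply/eqP; rewrite -addr_eq0 !pmulrn -!rmorphM -rmorphD /= -pE.
    by rewrite -pmulrn pcharf0.
  have -> : `|b|%N%:R ^+ 2 = b%:~R ^+ 2 :> F.
    rewrite pmulrn; have [->|->] : `|b|%N%:Z = b \/ `|b|%N%:Z = - b by lia.
      by [].
    by rewrite rmorphN sqrrN.
  have -> : c%:R ^+ 2 * (k1 * d%:R ^+ 2) = k1 * (- (c%:R * d%:R)) ^+ 2 by ring.
  rewrite -abE.
  have -> : k1 * (a%:R * b%:~R) ^+ 2 = k1 * a%:R ^+ 2 * b%:~R ^+ 2 by ring.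
  by rewrite kac; ring.
have db_gt0 : (0 < maxn d `|b|)%N by have := prime_gt0 p_prime; nia.
have := min_a _ _ db_gt0 kdb => b_ge.
(* b <= -a would give c d = p - a b > a^2, but c and d are below a. *)
have b_gt0 : a%:Z <= b.
  have [|b_le] : a%:Z <= b \/ b <= - a%:Z by lia.
    by [].
  have : a%:Z * b <= - (a%:Z * a%:Z) by nia.
  have : c%:Z * d%:Z <= a%:Z * a%:Z by nia.
  lia.
have [b' b'E] : exists b' : nat, b = b' by exists `|b|%N; lia.
rewrite {}b'E in pE b_gt0 b_ge kdb *.
have pE' : p = (a * b' + c * d)%N by lia.
have lt : (maxn c d < minn a b')%N by lia.
exists b', d; split=> //; first lia.
(* [d = 0] would make the solution degenerate and force [c = 0]. *)
rewrite lt0n; apply/eqP => d0.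
by have [] := degenerate_sol p_prime pE' lt; lia.
Qed.

(** The vector [(m, 1)] satisfies the relation, so there is a nonzero one of least sup norm
    [n <= m]. Its coordinates are nonzero and distinct, and the larger one serves as [a], after an
    exchange of axes if necessary. *)
Lemma primitive_sol_exists (F : fieldType) (p : nat) (m : nat) :
  p \in [pchar F] -> (1 < m)%N -> (m.*2 < p)%N ->
  exists a b c d, primitive_sol p 1 (m%:R ^+ 2 : F) a b c d.
Proof.
move=> charF m_gt1 m2_lt.
pose P n := `[< exists x y, [/\ maxn x y = n, (0 < n)%N &
  sqr_prop 1 (m%:R ^+ 2 : F) x y] >].
have kP : sqr_prop 1 (m%:R ^+ 2 : F) m 1 by rewrite /sqr_prop mul1r expr1n mulr1.
have exP : exists n, P n.
  by exists m; apply/asboolP; exists m, 1%N; split=> //; lia.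
case: (ex_minnP exP) => n /asboolP[x [y [xyn n_gt0 kxy]]] min_n.
have min_xy x' y' : (0 < maxn x' y')%N -> sqr_prop 1 (m%:R ^+ 2 : F) x' y' ->
    (n <= maxn x' y')%N.
  by move=> gt0 k; apply: min_n; apply/asboolP; exists x', y'.
have n_le : (n <= m)%N.
  by have := min_xy m 1%N; rewrite (maxn_idPl _) //; [apply=> //; lia | lia].
have m_neq0 : m%:R != 0 :> F by rewrite (prime_lt_charF charF) //; lia.
have y_gt0 : (0 < y)%N.
  rewrite lt0n; apply/eqP => y0; move: kxy.
  rewrite /sqr_prop y0 expr0n mulr0 mul1r => /eqP; rewrite sqrf_eq0.
  by apply/negP; rewrite (prime_lt_charF charF) //; lia.
have x_gt0 : (0 < x)%N.
  rewrite lt0n; apply/eqP => x0; move: kxy.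
  rewrite /sqr_prop x0 expr0n mulr0 => /esym/eqP.
  rewrite mulf_eq0 !sqrf_eq0 (negPf m_neq0).
  by apply/negP; rewrite (prime_lt_charF charF) //; lia.
have [xy|xy|xy] := ltngtP x y.
- have [||||b [d sol]] := @minimal_vector_extends F p (m%:R ^+ 2) 1 y x charF.
  + by lia.
  + by lia.
  + exact: esym.
  + by move=> x' y' gt0 k; have := min_xy y' x'; rewrite maxnC => /(_ gt0 (esym k)); lia.
  by exists b, y, d, x; apply: primitive_sol_swap.
- have [||||b [d sol]] := @minimal_vector_extends F p 1 (m%:R ^+ 2) x y charF.
  + by lia.
  + by lia.
  + by [].
  + by move=> x' y' gt0 k; have := min_xy x' y' gt0 k; lia.
  by exists x, b, y, d.
(* Equal coordinates would give [m ^+ 2 = 1] in [F], yet [m - 1] and [m + 1] lie strictly between 0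
   and [p]. *)
- exfalso; subst y; move: kxy; rewrite /sqr_prop => /mulIf.
  rewrite sqrf_eq0 (prime_lt_charF charF) => [/(_ isT)/esym/eqP|]; last lia.
  rewrite -[X in _ == X](expr1n _ 2) eqf_sqr => /orP[].
    rewrite -(prednK (ltnW m_gt1)) -natr1 -subr_eq0 addrK.
    by apply/negP; rewrite (prime_lt_charF charF) //; lia.
  rewrite -addr_eq0 natr1.
  by apply/negP; rewrite (prime_lt_charF charF) //; lia.
Qed.

(** * The class of a solution *)

(** The class is [a / c] up to sign. It is not 0 because [0 < a < p], and not 1 or -1 because
    [a - c] and [a + c] lie strictly between 0 and [p]. *)
Lemma primitive_sol_index (F : fieldType) (p a b c d : nat) :
  p \in [pchar F] -> (forall x : F, exists2 r, (r < p)%N & x = r%:R) ->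
  p = (a * b + c * d)%N -> (maxn c d < minn a b)%N -> (0 < c)%N -> (0 < d)%N ->
  exists2 m, (1 < m)%N && (m.*2 <= p)%N & primitive_sol p 1 (m%:R ^+ 2 : F) a b c d.
Proof.
move=> charF natF pE lt c_gt0 d_gt0.
have [r r_lt rE] := natF (a%:R / c%:R).
(* The representative of [r] or [- r] that is at most [p / 2]; both have the same square. *)
pose m := minn r (p - r).
have c_neq0 : c%:R != 0 :> F by rewrite (prime_lt_charF charF) //; nia.
have a_neq0 : a%:R != 0 :> F by rewrite (prime_lt_charF charF) //; nia.
have m2 : m%:R ^+ 2 = (a%:R / c%:R) ^+ 2 :> F.
  rewrite rE /m /minn; case: ifP => // _.
  by rewrite natrB ?(ltnW r_lt) // (pcharf0 charF) sub0r sqrrN.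
have ma : m%:R ^+ 2 * c%:R ^+ 2 = a%:R ^+ 2 :> F by rewrite m2 -exprMn divfK.
exists m; last by split=> //; rewrite /sqr_prop mul1r ma.
have m_neq0 : m != 0%N.
  apply/eqP => m0; move: ma; rewrite m0 expr0n mul0r => /esym/eqP.
  by rewrite sqrf_eq0 (negPf a_neq0).
have m_neq1 : m != 1%N.
  apply/eqP => m1; move: ma; rewrite m1 expr1n mul1r => /esym/eqP.
  rewrite eqf_sqr => /orP[].
    rewrite -subr_eq0 -natrB; last lia.
    by apply/negP; rewrite (prime_lt_charF charF) //; nia.
  rewrite -addr_eq0 -natrD.
  by apply/negP; rewrite (prime_lt_charF charF) //; nia.
by rewrite /m in m_neq0 m_neq1 *; lia.
Qed.

Lemma primitive_sol_index_unique (F : fieldType) (p m n a b c d : nat) :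
  p \in [pchar F] -> (0 < m)%N -> (0 < n)%N -> (m.*2 < p)%N -> (n.*2 < p)%N ->
  primitive_sol p 1 (m%:R ^+ 2 : F) a b c d ->
  primitive_sol p 1 (n%:R ^+ 2 : F) a b c d -> m = n.
Proof.
move=> charF m_gt0 n_gt0 m_lt n_lt [pE lt c_gt0 d_gt0 km] [_ _ _ _ kn].
wlog mn : m n m_gt0 n_gt0 m_lt n_lt km kn / (m <= n)%N.
  by move=> H; have [le|/ltnW le] := leqP m n; [|symmetry]; apply: H.
have c2 : c%:R ^+ 2 != 0 :> F.
  by rewrite sqrf_eq0 (prime_lt_charF charF) //; nia.
have : n%:R ^+ 2 == m%:R ^+ 2 :> F by apply/eqP/(mulIf c2); rewrite -km -kn.
rewrite eqf_sqr => /orP[].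
  rewrite -subr_eq0 -natrB // -(dvdn_pcharf charF) => /dvdnP[[|k]]; first lia.
  by rewrite mulSn; lia.
rewrite -addr_eq0 -natrD -(dvdn_pcharf charF) => /dvdnP[[|k]]; first lia.
by rewrite mulSn; lia.
Qed.

End Lattice.

Local Open Scope classical_set_scope.
Local Open Scope card_scope.

(** * Counting the solutions *)

(** The correspondence between solutions and indices is known only through existence and uniqueness
    statements; choice turns such a relation into a bijection. *)
Lemma card_eq_rel (T : Type) (U : pointedType) (A : set T) (B : set U)
    (Q : T -> U -> Prop) :
  (forall x, A x -> exists2 y, B y & Q x y) ->
  (forall y, B y -> exists2 x, A x & Q x y) ->
  (forall x y y', A x -> B y -> B y' -> Q x y -> Q x y' -> y = y') ->
  (forall x x' y, A x -> A x' -> B y -> Q x y -> Q x' y -> x = x') ->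
  A #= B.
Proof.
move=> QA QB Q_fun Q_inj.
have [f fP] : {f : T -> U & forall x, A x -> B (f x) /\ Q x (f x)}.
  apply: (@choice _ _ (fun x y => A x -> B y /\ Q x y)) => x.
  (* Outside [A] any value will do, and [point] serves as default. *)
  have [Ax|nAx] := pselect (A x); last by exists point.
  by have [y By Qxy] := QA _ Ax; exists y.
apply/card_set_bijP; exists f; split.
- by move=> x /fP[].
- move=> x x' /set_mem Ax /set_mem Ax' fxx'.
  have [Bx Qx] := fP _ Ax; have [_ Qx'] := fP _ Ax'.
  by apply: (Q_inj x x' (f x)) => //; rewrite fxx'.
- move=> y By; have [x Ax Qxy] := QB _ By; exists x => //.
  by have [Bx Qx] := fP _ Ax; apply: (Q_fun x).
Qed.

Theorem theorem1p1 (p : nat) (p_prime : prime p) (p_odd : odd p) :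
  [set x : nat * nat * nat * nat |
    let: (a, b, c, d) := x in
    p = a * b + c * d /\ maxn c d < minn a b] #= `I_((p + 1) %/ 2).
Proof.
have charF := pchar_Fp p_prime.
have natF (x : 'F_p) : exists2 r, (r < p)%N & x = (r%:R)%R.
  exists x; last by rewrite natr_Zp.
  by rewrite -[X in _ < X](Fp_cast p_prime).
have p_gt2 : 2 < p by have := prime_gt1 p_prime; lia.
(* (1, p, 0, 0) and (p, 1, 0, 0) take the two indices 0 and 1 left free by the
   slopes 2 <= m <= (p - 1) / 2. *)
pose Q (x : nat * nat * nat * nat) (m : nat) := let: (a, b, c, d) := x in
  if (c == 0) || (d == 0) then m = (a != 1)
  else 1 < m /\ primitive_sol p 1%R (m%:R ^+ 2 : 'F_p)%R a b c d.
have m_neq0 (m : nat) : 0 < m -> m.*2 < p -> (m%:R ^+ 2 != 0 :> 'F_p)%R.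
  move=> m_gt0 m_lt; rewrite GRing.sqrf_eq0 (prime_lt_charF charF) //; lia.
apply: (card_eq_rel (Q := Q)).
- move=> [[[a b] c] d] /= [pE lt].
  have [cd0|cd_neq0] := boolP ((c == 0) || (d == 0)).
    by exists (a != 1 : nat); rewrite //=; case: (_ != _); lia.
  have [||m /andP[m_gt1 m_le] sol] := primitive_sol_index charF natF pE lt; [lia..|].
  (* Since [p] is odd, [m.*2 <= p] amounts to [m < (p + 1) %/ 2]. *)
  by exists m => /=; [lia|split].
- move=> m /= m_lt; have [m_le1|m_gt1] := leqP m 1.
    exists (if m == 0 then (1, p, 0, 0) else (p, 1, 0, 0)).
      by case: ifP => _; split=> /=; lia.
    by rewrite /Q; case: ifP => m0 /=; lia.
  have [|a [b [c [d sol]]]] := primitive_sol_exists charF m_gt1; first lia.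
  exists (a, b, c, d); first by case: sol.
  by rewrite /Q ifF //; case: sol => _ _; lia.
- move=> [[[a b] c] d] m n _ /= m_lt n_lt; rewrite /Q.
  case: ifP => [_ -> ->//|_ [m_gt1 solm] [n_gt1 soln]].
  by apply: (primitive_sol_index_unique charF _ _ _ _ solm soln); lia.
- move=> [[[a b] c] d] [[[a' b'] c'] d'] m /= [pE lt] [pE' lt'] m_lt; rewrite /Q.
  case: ifP => [cd0|_]; case: ifP => [cd0'|_].
  + have [-> -> ab] := degenerate_sol p_prime pE lt cd0.
    have [-> -> ab'] := degenerate_sol p_prime pE' lt' cd0'.
    move=> -> e; congr (_, _, _, _); lia.
  + by move=> -> []; case: (_ != _).
  + by move=> [m_gt1 _] e; move: m_gt1; rewrite e; case: (_ != _).
  + move=> [m_gt1 sol] [_ sol'].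
    have [||-> -> -> ->//] := primitive_sol_unique charF _ _ sol sol'.
      exact: GRing.oner_neq0.
    by apply: m_neq0; lia.
Qed.
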